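(* Let $N\ge 1$ be an integer and let $f(s)=\sum_{k\ge 0}p_k s^k$ be the offspring probability generating function of a Bienaymé–Galton–Watson process, with $f(1)=1$, $p_k<1$ for all $k$, and $p_k>0$ for some $k>N$. For $n\ge 1$ let $\nu_n=1+Z_1+\cdots+Z_n$ be the total number of individuals in the first $n+1$ generations, let $V_{N,n}$ be the number of disjoint complete $N$-ary subtrees of height at least $n$ rooted at the ancestor of the family tree, and put $$\psi_{N,n}(s)=E\left(s^{\nu_n};V_{N,n}>0\right),\qquad \phi_{N,n}(s)=E\left(s^{\nu_n};V_{N,n}=0\right).$$ Then for all $n\ge 1$, all $s$ with $|s|\le 1$, and all $j=0,1,2,\ldots$ $$E\left(s^{\nu_{n+1}};V_{N,n+1}=j\right)=s\,G_N\left(\psi_{N,n}(s),\phi_{N,n}(s);j\right),$$ where $G_N(x,y;j)=\sum_{k=jN}^{jN+N-1}\frac{x^k}{k!}f^{(k)}(y)$.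
   Context: The process starts with one ancestor (the root, height 0), $Z_0=1$; each individual independently has $k$ children with probability $p_k$, where $p_k\ge 0$, $\sum_k p_k=1$; $Z_n$ is the size of generation $n$. The family tree has the individuals as nodes and the parent–child relations as arcs; the height of a node is its generation, and the height of a subtree is the maximum height of its nodes. A complete $N$-ary tree of height $n$ is a rooted tree in which every node at height less than $n$ has exactly $N$ children and nodes at height $n$ have none (the first $n$ generations of the deterministic branching process with offspring generating function $s^N$). Subtrees considered are those rooted at the ancestor; two such subtrees are disjoint if they have no common node other than the root. $V_{N,n}$ is the (maximal) number of pairwise disjoint complete $N$-ary subtrees of height at least $n$ rooted at the ancestor. $E(X;A)$ denotes $E(X\mathbf 1_A)$. $f^{(k)}$ denotes the $k$-th derivative of $f$ ($f^{(0)}=f$), and $0^0=1$. *)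

(* Defs.v *)
From HB Require Import structures.
From mathcomp Require Import all_boot all_order all_algebra.
From mathcomp Require Import complex.
From mathcomp Require Import all_classical all_reals all_analysis.

Set Implicit Arguments.
Unset Strict Implicit.
Unset Printing Implicit Defensive.

Import Order.TTheory GRing.Theory Num.Theory.
Import numFieldNormedType.Exports.

Local Open Scope classical_set_scope.
Local Open Scope ring_scope.

(* Individuals are Ulam-Harris words: the ancestor is [::] and rcons u i is the
   i-th child (counted from 0) of u, so the height of u is size u.  A family tree
   is encoded by x : seq nat -> nat, where x u is the number of children of u;
   x u is ignored when u is not a node. *)
Fixpoint generation (x : seq nat -> nat) (n : nat) : seq (seq nat) :=
  if n is m.+1
  then [seq rcons u i | u <- generation x m, i <- iota 0 (x u)]
  else [:: [::]].

Definition gen_size (x : seq nat -> nat) (n : nat) : nat :=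
  size (generation x n).

Definition total_progeny (x : seq nat -> nat) (n : nat) : nat :=
  1 + \sum_(1 <= m < n.+1) gen_size x m.

Definition family_tree (x : seq nat -> nat) : set (seq nat) :=
  [set u | u \in generation x (size u)].

Definition children_in (S : set (seq nat)) (u : seq nat) : set (seq nat) :=
  [set v | S v /\ exists i, v = rcons u i].

(* The first three clauses say that S is a subtree rooted at the ancestor. *)
Definition complete_subtree (N m : nat) (x : seq nat -> nat)
    (S : set (seq nat)) : Prop :=
  [/\ S `<=` family_tree x,
      S [::],
      forall u i, S (rcons u i) -> S u,
      forall u, S u -> (size u < m)%N -> (children_in S u #= `I_N)%card
    & forall u, S u -> size u = m -> children_in S u = set0].

Definition has_disjoint_subtrees (N n : nat) (x : seq nat -> nat)
    (j : nat) : Prop :=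
  exists S : 'I_j -> set (seq nat),
    (forall a, exists2 m, (n <= m)%N & complete_subtree N m x (S a)) /\
    (forall a b, a != b -> S a `&` S b `<=` [set [::]]).

(* The maximum exists for N, n >= 1, since disjoint subtrees then use disjoint
   nonempty sets of children of the ancestor; otherwise xget may return its
   default value 0. *)
Definition num_disjoint_subtrees (N n : nat) (x : seq nat -> nat) : nat :=
  xget 0%N [set j | has_disjoint_subtrees N n x j /\
                    forall i, has_disjoint_subtrees N n x i -> (i <= j)%N].

Section process.
Context {R : realType} {d : measure_display} {Omega : measurableType d}.
Variable P : probability Omega R.

Definition mutually_independent (I : choiceType) (X : I -> {RV P >-> nat}) :
    Prop :=
  forall (s : seq I) (B : I -> set nat), uniq s ->
    P (\bigcap_(u in [set` s]) X u @^-1` B u) =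
    (\prod_(u <- s) P (X u @^-1` B u))%E.

Definition galton_watson (p : nat -> R) (xi : seq nat -> {RV P >-> nat}) :
    Prop :=
  (forall u k, P (xi u @^-1` [set k]) = (p k)%:E) /\ mutually_independent xi.

Definition cexpectation (X : Omega -> R[i]) : R[i] :=
  Complex (fine 'E_P[fun w => complex.Re (X w)])
          (fine 'E_P[fun w => complex.Im (X w)]).

Definition cexpectation_on (X : Omega -> R[i]) (A : set Omega) : R[i] :=
  cexpectation (fun w => X w * \1_A w).

Variable xi : seq nat -> {RV P >-> nat}.

Definition nu (n : nat) (w : Omega) : nat :=
  total_progeny (fun u => xi u w) n.

Definition V (N n : nat) (w : Omega) : nat :=
  num_disjoint_subtrees N n (fun u => xi u w).

Definition psi (N n : nat) (s : R[i]) : R[i] :=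
  cexpectation_on (fun w => s ^+ nu n w) [set w | (0 < V N n w)%N].

Definition phi (N n : nat) (s : R[i]) : R[i] :=
  cexpectation_on (fun w => s ^+ nu n w) [set w | V N n w = 0%N].

End process.

(* The topology and the normed module structure of the complex plane are
   carried by R[i]^o. *)
Definition pgf {R : realType} (p : nat -> R) (s : R[i]^o) : R[i]^o :=
  limn (series (fun k => (real_complex R (p k) * s ^+ k : R[i]^o))).

(* f^`(k) is the complex derivative, applied in the open unit disc only: the
   second argument y will satisfy `|y| <= P(V = 0) < 1. *)
Definition G {R : realType} (N : nat) (f : R[i]^o -> R[i]^o) (x y : R[i])
    (j : nat) : R[i] :=
  \sum_(j * N <= k < j * N + N) x ^+ k / (k`!)%:R * (f^`(k))%classic y.

(* Main.v *)
(* Only the first n generations of the family tree matter for nu_n and for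
   [V_n > 0], and these truncated trees form a countable set.  By independence a
   truncated tree has probability the product of the p_k over its nodes, so
   given k children of the ancestor the k subtrees are independent copies of
   the process.  A complete N-ary subtree of height n + 1 exists below a node
   iff at least N of its children carry one of height n; hence V_{n+1} is the
   integer quotient by N of the number of such children of the ancestor, and
   nu_{n+1} is 1 plus the sum of the sizes of the k subtrees.  Splitting over
   k and over the set of children carrying a subtree gives
   s * sum_k p_k sum_l C(k, l) psi^l phi^(k - l), with l ranging over
   jN, ..., jN + N - 1.  Exchanging the sums, the coefficient of psi^l is the
   l-th derivative of f at phi divided by l!; this uses termwise
   differentiation in the open unit disc, where phi lies because a tree in
   which every node has k > N children, p_k > 0, has positive probability. *)
Require Import Defs.
From HB Require Import structures.
From mathcomp Require Import all_boot all_order all_algebra.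
From mathcomp Require Import complex finmap ring lra.
From mathcomp Require Import all_classical all_reals all_analysis.
From mathcomp Require Import measurable_realfun.

Set Implicit Arguments.
Unset Strict Implicit.
Unset Printing Implicit Defensive.

Import Order.TTheory GRing.Theory Num.Theory.
Import numFieldNormedType.Exports.

Local Open Scope classical_set_scope.
Local Open Scope ring_scope.

(** * Complete subtrees and coded truncated trees *)

Definition child_tree (x : seq nat -> nat) (i : nat) : seq nat -> nat :=
  fun u => x (i :: u).

(** [generation] extends words at their end, whereas the branching recursion splits a tree at the
    ancestor. This identity regroups a generation by first letter. *)
Lemma generation_shift (x : seq nat -> nat) (n : nat) :
  generation x n.+1 =
  flatten [seq [seq i :: v | v <- generation (child_tree x i) n]
          | i <- iota 0 (x [::])].
Proof.
elim: n => [|n IHn].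
  by rewrite /= cats0 -[LHS]/(map (cons^~ [::]) _); elim: (iota _ _) => //= i s ->.
rewrite [LHS]/= -/(generation x n.+1) IHn.
elim: (iota 0 (x [::])) => //= i s IHs.
rewrite map_cat flatten_cat IHs; congr (_ ++ _).
rewrite map_flatten -!map_comp; congr flatten.
by apply: eq_map => v /=; rewrite -map_comp.
Qed.

Lemma mem_cons_family_tree (x : seq nat -> nat) (i : nat) (v : seq nat) :
  family_tree x (i :: v) <-> (i < x [::])%N /\ family_tree (child_tree x i) v.
Proof.
rewrite /family_tree /mkset [size (i :: v)]/= generation_shift.
split=> [/flattenP[s /mapP[j]]|[lt_i_x v_in]].
  rewrite mem_iota => /andP[_ lt_j] -> /mapP[w w_in [ij vw]]; subst w.
  by rewrite ij; split.
apply/flattenP; exists [seq i :: v | v <- generation (child_tree x i) (size v)].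
  by apply/mapP; exists i; rewrite ?mem_iota.
by apply/mapP; exists v.
Qed.

(* The subtree of the descendants of u, cut at n generations below u; coding it
   by a natural number makes it a discrete random variable. *)
Fixpoint tree_code (x : seq nat -> nat) (n : nat) (u : seq nat) : nat :=
  if n is m.+1
  then CodeSeq.code [seq tree_code x m (rcons u i) | i <- iota 0 (x u)]
  else 0%N.

Fixpoint code_size (n t : nat) : nat :=
  if n is m.+1 then (\sum_(c <- CodeSeq.decode t) code_size m c).+1 else 1%N.

(* Whether the tree coded by t contains a complete N-ary subtree of height n. *)
Fixpoint code_good (N n t : nat) : bool :=
  if n is m.+1 then (N <= count (code_good N m) (CodeSeq.decode t))%N else true.

(** For [n] and [N] positive this is the value of V: each disjoint subtree uses up [N] children of
    the ancestor that carry subtrees of height [n.-1]. *)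
Definition code_subtrees (N n t : nat) : nat :=
  count (code_good N n.-1) (CodeSeq.decode t) %/ N.

Lemma tree_code_shift (x : seq nat -> nat) (n i : nat) (u : seq nat) :
  tree_code x n (i :: u) = tree_code (child_tree x i) n u.
Proof.
elim: n u => //= n IHn u; congr CodeSeq.code; apply: eq_map => k.
by rewrite -IHn.
Qed.

Lemma decode_tree_code (x : seq nat -> nat) (n : nat) :
  CodeSeq.decode (tree_code x n.+1 [::]) =
  [seq tree_code (child_tree x i) n [::] | i <- iota 0 (x [::])].
Proof.
rewrite /= CodeSeq.codeK; apply: eq_map => i; exact: tree_code_shift.
Qed.

Lemma gen_size_shift (x : seq nat -> nat) (n : nat) :
  gen_size x n.+1 = (\sum_(i <- iota 0 (x [::])) gen_size (child_tree x i) n)%N.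
Proof.
rewrite /gen_size generation_shift size_flatten /shape sumnE.
rewrite -map_comp big_map; apply: eq_bigr => i _.
by rewrite /= size_map.
Qed.

Lemma total_progeny_code (x : seq nat -> nat) (n : nat) :
  total_progeny x n = code_size n (tree_code x n [::]).
Proof.
elim: n x => [|n IHn] x; first by rewrite /total_progeny big_nil.
rewrite [RHS]/= -/(tree_code x n.+1 [::]) decode_tree_code big_map.
rewrite /total_progeny add1n big_add1 /=; congr S.
under eq_bigr do rewrite gen_size_shift.
rewrite exchange_big /=; apply: eq_bigr => i _; rewrite -IHn /total_progeny.
by rewrite big_nat_recl // big_add1 /=.
Qed.

(** Cardinalities are traded for explicit duplicate-free lists, which can be filtered, cut into
    blocks and compared in size. *)
Lemma card_nat_seqP (A : set nat) (k : nat) :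
  (A #= `I_k)%card <->
  exists l : seq nat, [/\ uniq l, size l = k & forall i, A i <-> i \in l].
Proof.
split=> [cardA|[l [uniq_l <- A_l]]].
  have finA : finite_set A by exists k.
  exists (enum_fset (fset_set A)); split=> [||i]; first exact: fset_uniq.
    exact: (@card_fset_set _ A).
  by rewrite -[i \in _]/(i \in fset_set A) in_fset_set //; split=> [/mem_set|/set_mem].
have -> : A = [set` [fset i in l]%fset].
  by apply/seteqP; split=> i /=; rewrite !inE => /A_l.
by apply/card_eq_fsetP; rewrite card_fseq undup_id.
Qed.

Lemma card_childrenP (S : set (seq nat)) (u : seq nat) (k : nat) :
  (children_in S u #= `I_k)%card <->
  exists l : seq nat,
    [/\ uniq l, size l = k & forall i, S (rcons u i) <-> i \in l].
Proof.
rewrite -(card_nat_seqP [set i | S (rcons u i)]).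
have -> : children_in S u = rcons u @` [set i | S (rcons u i)].
  apply/seteqP; split=> [v [Sv [i vE]]|_ [i Si <-]]; first by exists i; rewrite /= -vE.
  by split=> //; exists i.
have rcons_inj : injective (rcons u) by move=> i j /rcons_inj[].
by rewrite (card_eql (inj_card_eq (in2W rcons_inj))).
Qed.

(** * Complete subtrees and the counting of good children *)

Section Subtrees.
Variable N : nat.

Lemma complete_subtree_child (m : nat) (x : seq nat -> nat)
    (S : set (seq nat)) (i : nat) :
  complete_subtree N m.+1 x S -> S [:: i] ->
  (i < x [::])%N /\ complete_subtree N m (child_tree x i) [set v | S (i :: v)].
Proof.
move=> [S_tree S0 S_par S_card S_leaf] Si.
split; first by have /mem_cons_family_tree[] := S_tree _ Si.
split=> //.
- by move=> v /S_tree /mem_cons_family_tree[].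
- by move=> u j; rewrite /mkset -rcons_cons; exact: S_par.
- move=> u Su lt_u; have /card_childrenP[l [ul sl Sl]] := S_card _ Su lt_u.
  by apply/card_childrenP; exists l.
- move=> u Su sz_u; have S_u := S_leaf _ Su (congr1 succn sz_u).
  rewrite -subset0 => v [Sv [j v_eq]]; suff: children_in S (i :: u) (i :: v).
    by rewrite S_u.
  by split=> //; exists j; rewrite v_eq.
Qed.

(** Grafts the sets [T i], for [i] in [l], below a common root; the values of [T] outside [l] are
    ignored, so any default may be used there. *)
Definition join_subtrees (l : seq nat) (T : nat -> set (seq nat)) :
    set (seq nat) :=
  [set u | if u is i :: v then i \in l /\ T i v else True].

Lemma complete_join_subtrees (n : nat) (x : seq nat -> nat) (l : seq nat)
    (T : nat -> set (seq nat)) :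
  uniq l -> size l = N ->
  (forall i, i \in l ->
     (i < x [::])%N /\ complete_subtree N n (child_tree x i) (T i)) ->
  complete_subtree N n.+1 x (join_subtrees l T).
Proof.
move=> uniq_l size_l lT; split=> //.
- case=> [|i v] /=; first by move=> _; rewrite /family_tree /= inE.
  by move=> [/lT[lt_i [T_tree]] _ _ _ _ Tv]; apply/mem_cons_family_tree; split; auto.
- case=> [|i v] //= k [il Tv]; split=> //.
  by have [_ [_ _ T_par _ _]] := lT _ il; exact: T_par Tv.
- case=> [|i v] /=.
    move=> _ _; apply/card_childrenP; exists l; split=> // i /=.
    split=> [[]|il] //; split=> //.
    by have [_ []] := lT _ il.
  move=> [il Tv]; rewrite ltnS => lt_v.
  have [_ [_ _ _ T_card _]] := lT _ il.
  have /card_childrenP[l' [u s Tl]] := T_card _ Tv lt_v.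
  apply/card_childrenP; exists l'; split=> // j; rewrite -Tl /=.
  by split=> [[]|].
- case=> [|i v] //= [il Tv] [sz_v]; have [_ [_ _ _ _ T_leaf]] := lT _ il.
  rewrite -subset0 => w [+ [j wE]]; rewrite wE => -[_ Tj].
  suff: children_in (T i) v (rcons v j) by rewrite T_leaf.
  by split=> //; exists j.
Qed.

Definition good_child (n : nat) (x : seq nat -> nat) (i : nat) : bool :=
  code_good N n (tree_code (child_tree x i) n [::]).

Lemma count_good_child (n : nat) (x : seq nat -> nat) :
  count (code_good N n) (CodeSeq.decode (tree_code x n.+1 [::])) =
  size [seq i <- iota 0 (x [::]) | good_child n x i].
Proof. by rewrite decode_tree_code count_map size_filter. Qed.

(** Induction on [n] with [m] free: the code of height [n] only sees the top of a possibly higher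
    subtree, and the [N] children of its root are all good. *)
Lemma complete_subtree_good (n m : nat) (x : seq nat -> nat)
    (S : set (seq nat)) :
  (n <= m)%N -> complete_subtree N m x S ->
  code_good N n (tree_code x n [::]).
Proof.
elim: n m x S => // n IHn [//|m] x S le_nm S_complete.
rewrite [X in is_true X]/= -/(tree_code x n.+1 [::]) count_good_child.
have [_ S0 _ /(_ [::] S0 isT)/card_childrenP[l [uniq_l <- Sl]] _] := S_complete.
apply: uniq_leq_size => // i /Sl Si; rewrite mem_filter mem_iota /= add0n.
have [lt_i S_i] := complete_subtree_child S_complete Si.
by rewrite lt_i andbT; exact: IHn S_i.
Qed.

(** Subtrees chosen below the first [N] good children are grafted under the root. *)
Lemma good_complete_subtree (n : nat) (x : seq nat -> nat) :
  code_good N n (tree_code x n [::]) -> exists S, complete_subtree N n x S.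
Proof.
elim: n x => [|n IHn] x.
  move=> _; exists [set [::]]; split=> //.
  - by move=> _ ->; rewrite /family_tree /= inE.
  - by case.
  - by move=> _ -> _; rewrite -subset0 => w [w0 [i wE]]; rewrite wE in w0.
rewrite [X in is_true X]/= -/(tree_code x n.+1 [::]) count_good_child.
set L := seq.filter _ _ => le_N_L.
have LT i : exists T, i \in L -> complete_subtree N n (child_tree x i) T.
  have [|_] := boolP (i \in L); last by exists set0.
  by rewrite mem_filter => /andP[/IHn[T T_i] _]; exists T.
have [T T_L] := choice LT.
exists (join_subtrees (take N L) T); apply: complete_join_subtrees.
- by rewrite take_uniq // filter_uniq // iota_uniq.
- by rewrite size_takel.
- move=> i /mem_take iL; split; last exact: T_L.
  by move: iL; rewrite mem_filter mem_iota add0n => /andP[].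
Qed.

(** Each subtree occupies [N] good children of the ancestor, and disjointness keeps these groups
    apart. Conversely, the list of good children is cut into [j] consecutive blocks of length [N],
    each supporting one subtree. *)
Lemma has_disjoint_subtreesP (n : nat) (x : seq nat -> nat) (j : nat) :
  has_disjoint_subtrees N n.+1 x j <->
  (j * N <= count (code_good N n) (CodeSeq.decode (tree_code x n.+1 [::])))%N.
Proof.
rewrite count_good_child; set L := seq.filter _ _.
split=> [[S [S_compl S_disj]]|le_L].
  have Sl a : exists l : seq nat, [/\ uniq l, size l = N &
      forall i, i \in l -> S a [:: i] /\ i \in L].
    have [[//|m] lt_nm Sa] := S_compl a.
    have [_ S0 _ /(_ [::] S0 isT)/card_childrenP[l [ul sl Sl]] _] := Sa.
    exists l; split=> // i /Sl Si; split=> //.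
    have [lt_i S_i] := complete_subtree_child Sa Si.
    rewrite mem_filter mem_iota add0n lt_i leq0n !andbT.
    exact: (@complete_subtree_good n m _ _ lt_nm S_i).
  have [l l_S] := choice Sl.
  (* [c (a, b)] is the [b]-th child of the ancestor in the subtree [S a]. Its injectivity places
     [j * N] distinct elements in [L]. *)
  pose c (p : 'I_j * 'I_N) := nth 0%N (l p.1) p.2.
  have c_in p : c p \in l p.1.
    by have [_ sl _] := l_S p.1; rewrite mem_nth ?sl.
  have c_inj : injective c.
    move=> [a b] [a' b'] c_eq.
    have := c_in (a, b); have := c_in (a', b'); rewrite -c_eq /=.
    have [_ _ S_a] := l_S a; have [_ _ S_a'] := l_S a'.
    move=> /S_a'[Sa'c _] /S_a[Sac _].
    (* A child common to two different subtrees would be a shared node other than the root. *)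
    have [a_eq|/S_disj disj] := eqVneq a a'; last first.
      by have := disj [:: c (a, b)] (conj Sac Sa'c).
    subst a'; congr pair; apply/val_inj/eqP.
    have [ul sl _] := l_S a.
    have : nth 0%N (l a) b == nth 0%N (l a) b' by apply/eqP; exact: c_eq.
    by rewrite nth_uniq ?sl.
  rewrite -[X in (X <= _)%N](_ : size [seq c p | p <- enum {: 'I_j * 'I_N}] = _).
    apply: uniq_leq_size; first by rewrite map_inj_uniq // enum_uniq.
    move=> _ /mapP[p _ ->]; have [_ _ S_a] := l_S p.1.
    by have [] := S_a _ (c_in p).
  by rewrite size_map -cardE card_prod !card_ord.
have LT i : exists T, i \in L -> complete_subtree N n (child_tree x i) T.
  have [|_] := boolP (i \in L); last by exists set0.
  rewrite mem_filter => /andP[/good_complete_subtree[T T_i] _]; by exists T.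
have [T T_L] := choice LT.
have uniq_L : uniq L by rewrite filter_uniq // iota_uniq.
have bound (a : 'I_j) b : (b < N)%N -> (a * N + b < size L)%N.
  move=> lt_b; apply: leq_trans le_L; apply: (@leq_trans (a.+1 * N)%N).
    by rewrite mulSn addnC ltn_add2r.
  by rewrite leq_mul2r ltn_ord orbT.
pose l (a : 'I_j) := [seq nth 0%N L (a * N + b) | b <- iota 0 N].
exists (fun a => join_subtrees (l a) T); split=> [a|a b ne_ab].
  exists n.+1 => //; apply: complete_join_subtrees.
  - rewrite map_inj_in_uniq ?iota_uniq // => b c.
    rewrite !mem_iota !add0n /= => lt_b lt_c /eqP.
    by rewrite nth_uniq ?bound // eqn_add2l => /eqP.
  - by rewrite size_map size_iota.
  - move=> i /mapP[b]; rewrite mem_iota add0n /= => lt_b ->.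
    have iL := mem_nth 0%N (bound a b lt_b); split; last exact: T_L.
    by move: iL; rewrite mem_filter mem_iota add0n => /andP[].
(* A shared node other than the root has a first letter lying in both blocks; its position in [L] is
   [a * N + c] and also [b * N + c'], and dividing by [N] gives [a = b]. *)
case=> [|i v] //= [[/mapP[c + ->] _] [/mapP[c' + /eqP +] _]].
rewrite !mem_iota !add0n /= => lt_c lt_c'; rewrite nth_uniq ?bound // => /eqP.
have N_gt0 : (0 < N)%N by exact: leq_ltn_trans lt_c.
move=> /(congr1 (divn^~ N)); rewrite !divnMDl // !divn_small // !addn0.
by move=> /val_inj ab; rewrite ab eqxx in ne_ab.
Qed.

(** The largest [j] with [j * N] at most the count is the quotient by [N]; a maximum is unique, so
    [xget] returns it and not its default. *)
Lemma num_disjoint_subtrees_code (n : nat) (x : seq nat -> nat) :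
  (0 < N)%N ->
  num_disjoint_subtrees N n.+1 x = code_subtrees N n.+1 (tree_code x n.+1 [::]).
Proof.
move=> N_gt0; apply: xget_subset1; last first.
  move=> i j [hi maxi] [hj maxj]; apply/eqP.
  by rewrite eqn_leq maxi // maxj.
split=> [|i /has_disjoint_subtreesP]; last by rewrite /code_subtrees leq_divRL.
by apply/has_disjoint_subtreesP; exact: leq_divM.
Qed.

End Subtrees.

(** * Weights and node labels of tree codes *)

Section TreeLabels.
Variable K : comNzRingType.

(** Since [CodeSeq.decode] is a bijection, every number reads as a list of child codes. The event of
    having code [t] thus splits into one condition at [u] and one for each child. *)
Lemma tree_code_eq (x : seq nat -> nat) (n : nat) (u : seq nat) (t : nat) :
  let l := CodeSeq.decode t in
  tree_code x n.+1 u = t <->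
  x u = size l /\ forall i, (i < size l)%N -> tree_code x n (rcons u i) = nth 0%N l i.
Proof.
split=> [<- /=|[xu xi_eq] /=].
  rewrite CodeSeq.codeK size_map size_iota; split=> // i lt_i.
  by rewrite (nth_map 0%N) ?size_iota // nth_iota.
rewrite -[RHS]CodeSeq.decodeK; congr CodeSeq.code.
apply: (@eq_from_nth _ 0%N) => [|i]; rewrite size_map size_iota xu // => lt_i.
by rewrite (nth_map 0%N) ?size_iota // nth_iota // xi_eq.
Qed.

(* A natural number that does not code any tree of height n has weight 0. *)
Fixpoint code_weight (p : nat -> K) (n t : nat) : K :=
  if n is m.+1
  then p (size (CodeSeq.decode t)) * \prod_(c <- CodeSeq.decode t) code_weight p m c
  else (t == 0%N)%:R.

Fixpoint code_valid (n t : nat) : bool :=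
  if n is m.+1 then all (code_valid m) (CodeSeq.decode t) else t == 0%N.

(* The pairs (v, c) for which the code t, read at the node u, prescribes that v
   has c children. *)
Fixpoint code_labels (n : nat) (u : seq nat) (t : nat) : seq (seq nat * nat) :=
  if n is m.+1
  then (u, size (CodeSeq.decode t)) ::
       flatten [seq code_labels m (rcons u i) (nth 0%N (CodeSeq.decode t) i)
               | i <- iota 0 (size (CodeSeq.decode t))]
  else [::].

Lemma tree_code_valid (x : seq nat -> nat) (n : nat) (u : seq nat) :
  code_valid n (tree_code x n u).
Proof.
elim: n u => //= n IHn u; rewrite CodeSeq.codeK all_map.
by apply/allP => i _ /=.
Qed.

Lemma code_weight_invalid (p : nat -> K) (n t : nat) :
  ~~ code_valid n t -> code_weight p n t = 0.
Proof.
elim: n t => [|n IHn] t /=; first by case: eqP.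
case/allPn => c c_in /IHn c0; rewrite (big_rem c) //= c0.
by rewrite mul0r mulr0.
Qed.

(** Turns the event of having a given truncated tree into finitely many prescriptions of offspring
    numbers, the form to which independence applies. *)
Lemma code_labelsP (x : seq nat -> nat) (n : nat) (u : seq nat) (t : nat) :
  code_valid n t ->
  tree_code x n u = t <-> forall vc, vc \in code_labels n u t -> x vc.1 = vc.2.
Proof.
elim: n u t => [|n IHn] u t; first by move=> /= /eqP ->; split.
move=> /= t_valid; rewrite -/(tree_code x n.+1 u) tree_code_eq.
have c_valid i : (i < size (CodeSeq.decode t))%N ->
    code_valid n (nth 0%N (CodeSeq.decode t) i).
  by move=> lt_i; apply: (allP t_valid); exact: mem_nth.
split=> [[xu xi_eq] vc|x_eq].
  rewrite inE => /predU1P[->//|/flattenP[_ /mapP[i + ->]]].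
  rewrite mem_iota => /andP[_ lt_i] vc_in.
  by have /IHn := xi_eq i lt_i; apply => //; exact: c_valid.
split=> [|i lt_i]; first exact: (x_eq (u, size (CodeSeq.decode t)) (mem_head _ _)).
apply/IHn => [|vc vc_in]; first exact: c_valid.
apply: x_eq; rewrite inE; apply/orP; right; apply/flattenP.
eexists; last exact: vc_in.
by apply/mapP; exists i; rewrite ?mem_iota.
Qed.

Lemma code_labels_prefix (n : nat) (u : seq nat) (t : nat) vc :
  vc \in code_labels n u t -> prefix u vc.1.
Proof.
elim: n u t => // n IHn u t /=.
rewrite inE => /predU1P[->//|]; first by rewrite prefix_refl.
case/flattenP=> _ /mapP[i _ ->] /IHn; apply: prefix_trans.
exact: prefix_rcons.
Qed.

(** Independence is stated for distinct indices. The label [u] is shorter than all labels below it,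
    and labels below two siblings have different prefixes of the same length. *)
Lemma uniq_code_labels (n : nat) (u : seq nat) (t : nat) :
  uniq [seq vc.1 | vc <- code_labels n u t].
Proof.
elim: n u t => // n IHn u t /=; apply/andP; split.
  apply/mapP => -[vc /flattenP[_ /mapP[i _ ->]] /code_labels_prefix].
  by move=> /size_prefix + uE; rewrite -uE size_rcons ltnn.
elim: (iota _ _) (iota_uniq 0 (size (CodeSeq.decode t))) => //= i s IHs.
move=> /andP[i_s s_uniq]; rewrite map_cat cat_uniq IHn IHs // andbT /=.
apply/hasPn => _ /mapP[vc /flattenP[_ /mapP[j j_s ->]] /code_labels_prefix jp ->].
apply/mapP => -[vc' /code_labels_prefix ip vcE]; rewrite -vcE in ip.
move: ip jp => /prefixP[a ->] /prefixP[b]; rewrite !cat_rcons => /eqP.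
rewrite eqseq_cat // => /andP[_ /eqP[ij _]].
by rewrite ij j_s in i_s.
Qed.

Lemma prod_code_labels (p : nat -> K) (n : nat) (u : seq nat) (t : nat) :
  code_valid n t -> \prod_(vc <- code_labels n u t) p vc.2 = code_weight p n t.
Proof.
elim: n u t => [|n IHn] u t /=; first by rewrite big_nil => ->.
move=> t_valid; rewrite big_cons; congr (_ * _).
rewrite big_flatten big_map /= [RHS](big_nth 0%N) /index_iota subn0.
apply: eq_big_seq => i; rewrite mem_iota => /andP[_ lt_i].
by apply: IHn; apply: (allP t_valid); exact: mem_nth.
Qed.

(** The complete [k]-ary tree of height [n], the witness that keeps phi inside the open unit
    disc. *)
Fixpoint full_code (k n : nat) : nat :=
  if n is m.+1 then CodeSeq.code (nseq k (full_code k m)) else 0%N.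

(** The exponent counts the nodes of height less than [n]; only the positivity of the power matters
    later. *)
Lemma code_weight_full (p : nat -> K) (k n : nat) :
  exists m, code_weight p n (full_code k n) = p k ^+ m.
Proof.
elim: n => [|n [m IHn]]; first by exists 0%N.
exists (m * k).+1; rewrite /= CodeSeq.codeK size_nseq big_nseq IHn.
rewrite exprS exprM; congr (_ * _).
by move: (p k ^+ m) => y; elim: k {IHn} => //= i ->; rewrite exprS.
Qed.

Lemma code_good_full (N k n : nat) : (N <= k)%N -> code_good N n (full_code k n).
Proof.
move=> le_Nk; elim: n => //= n IHn.
by rewrite CodeSeq.codeK count_nseq IHn mul1n.
Qed.

End TreeLabels.

(** * Complex power series *)

Section ComplexLimits.
Variable R : realType.
Local Notation C := (R[i]^o).
Local Notation "x %:C" := (real_complex R x).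

Lemma norm_real_complex (a : R) : `|a%:C| = `|a|%:C.
Proof. by rewrite normc_def /= expr0n addr0 sqrtr_sqr. Qed.

Lemma norm_complexE (z : R[i]) : `|z| = (complex.Re `|z|)%:C.
Proof. by rewrite RRe_real. Qed.

Lemma complex_ReM (y z : R[i]) :
  complex.Re (y * z) = complex.Re y * complex.Re z - complex.Im y * complex.Im z.
Proof. by case: y z => [a b] [c e]. Qed.

Lemma complex_ImM (y z : R[i]) :
  complex.Im (y * z) = complex.Re y * complex.Im z + complex.Im y * complex.Re z.
Proof. by case: y z => [a b] [c e]. Qed.

Lemma norm_Im_le (z : R[i]) : `|complex.Im z|%:C <= `|z|.
Proof. by rewrite normc_def lecR -sqrtr_sqr ler_wsqrtr // lerDr sqr_ge0. Qed.

Lemma cvg_complex (u : nat -> C) (l : R[i]) :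
  (fun n => complex.Re (u n)) @ \oo --> complex.Re l ->
  (fun n => complex.Im (u n)) @ \oo --> complex.Im l ->
  u @ \oo --> (l : C).
Proof.
move=> uRe uIm; apply/cvgrPdist_lt => e e_gt0.
(* A positive element of [R[i]] is real, so it can be halved and shared between the real and the
   imaginary part. *)
have eE : e = (complex.Re e)%:C by rewrite RRe_real ?gtr0_real.
have e2_gt0 : 0 < complex.Re e / 2 by rewrite divr_gt0 // -ltcR -eE.
move/cvgrPdist_lt: uRe => /(_ _ e2_gt0) uRe.
move/cvgrPdist_lt: uIm => /(_ _ e2_gt0) uIm.
near=> n.
rewrite [l - u n]complexE [complex.Re _]raddfB [complex.Im _]raddfB.
rewrite (le_lt_trans (ler_normD _ _)) // normrM !norm_real_complex.
rewrite (_ : `|'i%C| = 1 :> R[i]) ?mul1r; last first.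
  by rewrite normc_def /= expr0n expr1n add0r sqrtr1.
rewrite eE -rmorphD /= ltcR (splitr (complex.Re e)) ltrD //.
- by near: n.
- by near: n.
Unshelve. all: end_near. Qed.

Lemma cvg_norm_le (u : nat -> C) (l B : R[i]) :
  u @ \oo --> (l : C) -> (forall n, `|u n| <= B) -> `|l| <= B.
Proof.
move=> ul uB; have B_ge0 : 0 <= B by exact: le_trans (uB 0%N).
have [//|lt_B] := real_leP (normr_real l) (ger0_real B_ge0).
have e_gt0 : 0 < `|l| - B by rewrite subr_gt0.
move/cvgrPdist_lt : ul => /(_ _ e_gt0) [n _ /(_ n (leqnn n)) /= lun].
have : `|l| < `|l|.
  rewrite -[X in `|X| < _](subrK (u n)) (le_lt_trans (ler_normD _ _)) //.
  by rewrite -[X in _ < X](subrK B) ltr_leD.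
by rewrite ltxx.
Qed.

(** Comparison test, applied separately to the real and the imaginary parts, both dominated by the
    modulus. *)
Lemma le_norm_complex_series (c : nat -> C) (b : nat -> R) :
  (forall n, `|c n| <= (b n)%:C) -> cvgn (series b) ->
  exists l : R[i], series c @ \oo --> (l : C).
Proof.
move=> cb b_cvg.
have Re_le n : `|complex.Re (c n)| <= b n.
  by rewrite -lecR (le_trans (normc_ge_Re _)).
have Im_le n : `|complex.Im (c n)| <= b n.
  by rewrite -lecR (le_trans (norm_Im_le _)).
have bnd (v : nat -> R) : (forall n, `|v n| <= b n) -> cvgn (series v).
  move=> vb; apply: normed_cvg; apply: series_le_cvg b_cvg => //= n.
  exact: le_trans (vb n).
have sRe n : complex.Re (series c n) = series (fun k => complex.Re (c k)) n.
  by rewrite /series /= raddf_sum.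
have sIm n : complex.Im (series c n) = series (fun k => complex.Im (c k)) n.
  by rewrite /series /= raddf_sum.
exists (Complex (limn (series (fun k => complex.Re (c k))))
                (limn (series (fun k => complex.Im (c k))))).
apply: cvg_complex => /=.
  by under eq_fun do rewrite sRe; exact: bnd.
by under eq_fun do rewrite sIm; exact: bnd.
Qed.

End ComplexLimits.

(** Second-order Taylor remainder of a monomial, bounded by its second derivative on the disc of
    radius [K]. The usual factor 1/2 is given up, so that the bound sums to the twice differentiated
    series. *)
Lemma norm_exprDsub_le (F : numDomainType) (z w K : F) (n : nat) :
  `|z| <= K -> `|w| <= K ->
  `|w ^+ n.+2 - z ^+ n.+2 - n.+2%:R * z ^+ n.+1 * (w - z)|
    <= (n.+2 * n.+1)%:R * K ^+ n * `|w - z| ^+ 2.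
Proof.
move=> zK wK; have K_ge0 : 0 <= K by exact: le_trans zK.
elim: n => [|n IHn].
  rewrite expr1 (_ : _ - _ - _ = (w - z) ^+ 2).
    by rewrite normrX muln1 expr0 mulr1 ler_peMl ?exprn_ge0 // ler1n.
  by rewrite sqrrB !expr2 mulr2n; ring.
(* The remainder at the next exponent is [w] times the previous one plus a quadratic term; in the
   bounds, (n+3)(n+2) = (n+2)(n+1) + 2(n+2). *)
have -> : w ^+ n.+3 - z ^+ n.+3 - n.+3%:R * z ^+ n.+2 * (w - z) =
   w * (w ^+ n.+2 - z ^+ n.+2 - n.+2%:R * z ^+ n.+1 * (w - z)) +
   n.+2%:R * z ^+ n.+1 * (w - z) ^+ 2.
  by rewrite -[n.+3%:R]natr1 !exprS; ring.
rewrite (le_trans (ler_normD _ _)) // !normrM normr_nat !normrX.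
have -> : (n.+3 * n.+2)%:R * K ^+ n.+1 * `|w - z| ^+ 2 =
   K * ((n.+2 * n.+1)%:R * K ^+ n * `|w - z| ^+ 2) +
   2 * n.+2%:R * K ^+ n.+1 * `|w - z| ^+ 2.
  by rewrite !natrM exprS -[n.+3%:R]natr1 -[n.+2%:R]natr1; ring.
apply: lerD; first by apply: ler_pM.
rewrite ler_wpM2r ?exprn_ge0 //; apply: ler_pM; rewrite ?exprn_ge0 //.
  by rewrite ler_peMl ?ler1n.
by rewrite lerXn2r ?nnegrE.
Qed.

Lemma cvg_seriesS (K : numFieldType) (V : normedModType K) (u : nat -> V) (l : V) :
  series u @ \oo --> l -> series (fun k => u k.+1) @ \oo --> l - u 0%N.
Proof.
move=> ul; have -> : series (fun k => u k.+1) = fun n => series u n.+1 - u 0%N.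
  by apply/funext => n; rewrite /series /= big_nat_recl // addrAC subrr add0r.
by apply: cvgB; [rewrite cvg_shiftS|exact: cvg_cst].
Qed.

(** * Termwise differentiation in the open unit disc *)

Section PowerSeries.
Variable R : realType.
Local Notation C := (R[i]^o).
Local Notation "x %:C" := (real_complex R x).

(** Radius of convergence at least 1. With nonnegative coefficients, convergence at the modulus of a
    complex point is absolute convergence at that point. *)
Definition disc_series (a : nat -> R) :=
  (forall k, 0 <= a k) /\ forall r, 0 <= r < 1 -> cvgn (pseries a r).

Lemma disc_series_diffs (a : nat -> R) :
  disc_series a -> disc_series (pseries_diffs a).
Proof.
move=> [a_ge0 a_cvg]; split=> [k|r /andP[r_ge0 r_lt1]].
  by rewrite mulr_ge0 // ler0n.
(* Any point strictly between [r] and 1 would do: the differentiated series at [r] is compared with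
   the original one at [t]. *)
pose t := (1 + r) / 2.
have rt : r < t by rewrite /t; lra.
have t01 : 0 <= t < 1 by rewrite /t; lra.
have t_ge0 : 0 <= t by case/andP: t01.
(* Mean value inequality for a power, which absorbs the factor [k.+1] at the cost of the constant
   [(t - r)^-1]. *)
have pow_le k : k.+1%:R * r ^+ k * (t - r) <= t ^+ k.+1 - r ^+ k.+1.
  elim: k => [|k IHk]; first by rewrite !expr1 expr0 !mul1r.
  have : t * (k.+1%:R * r ^+ k * (t - r)) <= t * (t ^+ k.+1 - r ^+ k.+1).
    by rewrite ler_wpM2l.
  have : 0 <= k.+1%:R * r ^+ k * (t - r) * (t - r).
    by rewrite !mulr_ge0 ?exprn_ge0 // subr_ge0 ltW.
  have := exprn_ge0 k r_ge0.
  rewrite -[k.+2%:R]natr1 !(exprS _ k.+1) (exprS r k).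
  set A := r ^+ k; set B := t ^+ k.+1; set D := k.+1%:R => ? ? ?; nra.
have cvg_t : cvgn (series (fun k => (t - r)^-1 * (a k.+1 * t ^+ k.+1))).
  by apply: is_cvg_seriesZ; apply/cvg_ex; eexists; exact: cvg_seriesS (a_cvg _ t01).
apply: series_le_cvg cvg_t => // k /=.
- by rewrite !mulr_ge0 ?exprn_ge0 ?ler0n.
- by rewrite !mulr_ge0 ?exprn_ge0 // invr_ge0 subr_ge0 ltW.
- rewrite /pseries_diffs ler_pdivlMl ?subr_gt0 //.
  rewrite mulrC -!mulrA mulrCA ler_wpM2l // mulrA.
  by rewrite (le_trans (pow_le k)) // lerBlDr lerDl exprn_ge0.
Qed.

Lemma cvg_pgf (a : nat -> R) (y : R[i]) : disc_series a -> `|y| < 1 ->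
  series (fun k => (a k)%:C * y ^+ k : C) @ \oo --> pgf a y.
Proof.
move=> [a_ge0 a_cvg] y_lt1; rewrite /pgf.
suff [l l_lim] : exists l : R[i],
    series (fun k => (a k)%:C * y ^+ k : C) @ \oo --> (l : C).
  by rewrite (cvg_lim (@norm_hausdorff _ _) l_lim).
have y01 : 0 <= complex.Re `|y| < 1.
  by rewrite -lecR -ltcR -norm_complexE normr_ge0.
apply: le_norm_complex_series (a_cvg _ y01) => n.
rewrite normrM norm_real_complex (ger0_norm (a_ge0 n)) normrX rmorphM /= rmorphXn /=.
by rewrite -norm_complexE.
Qed.

(** The monomial remainder bounds are summed; [M] is the twice differentiated series at [K], hence
    uniform over the disc of radius [K]. *)
Lemma pgf_taylor1_le (a : nat -> R) (K : R) : disc_series a -> 0 <= K < 1 ->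
  exists2 M : R[i], 0 <= M & forall y h : R[i], `|y| <= K%:C -> `|h + y| <= K%:C ->
    `|pgf a (h + y) - pgf a y - h * pgf (pseries_diffs a) y| <= M * `|h| ^+ 2.
Proof.
move=> a_disc K01; have [a_ge0 a_cvg] := a_disc.
have [a1_disc a2_disc] := (disc_series_diffs a_disc,
  disc_series_diffs (disc_series_diffs a_disc)).
pose s := pseries (pseries_diffs (pseries_diffs a)) K.
have s_cvg : cvgn s by have [_] := a2_disc; exact.
have K_ge0 : 0 <= K by case/andP: K01.
have s_le n : s n <= limn s.
  apply: nondecreasing_cvgn_le => //; apply: nondecreasing_series => k _ _.
  by rewrite mulr_ge0 ?exprn_ge0 //; have [] := a2_disc.
exists (limn s)%:C => [|y h yK hyK].
  by rewrite lecR (le_trans _ (s_le 0%N)) // /s /pseries /series /= big_nil.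
have K_lt1 : K%:C < 1 by rewrite ltcR; case/andP: K01.
have y_lt1 : `|y| < 1 by exact: le_lt_trans K_lt1.
have hy_lt1 : `|h + y| < 1 by exact: le_lt_trans K_lt1.
pose v k : C := k%:R * (a k)%:C * y ^+ k.-1.
have v_cvg : series v @ \oo --> pgf (pseries_diffs a) y.
  rewrite -cvg_shiftS /=.
  have -> : (fun n => series v n.+1) =
      series (fun k => (pseries_diffs a k)%:C * y ^+ k : C).
    apply/funext => n; rewrite /series /= big_nat_recl //.
    rewrite {1}/v !mul0r add0r; apply: eq_bigr => k _.
    by rewrite /v rmorphM /= rmorph_nat.
  exact: cvg_pgf.
pose e k : C := (a k)%:C * ((h + y) ^+ k - y ^+ k - k%:R * y ^+ k.-1 * h).
have e_cvg : series e @ \oo -->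
    (pgf a (h + y) - pgf a y - h * pgf (pseries_diffs a) y : C).
  have -> : series e = fun n => series (fun k => (a k)%:C * (h + y) ^+ k : C) n -
      series (fun k => (a k)%:C * y ^+ k : C) n - h * series v n.
    apply/funext => n; rewrite /series /= mulr_sumr -!sumrB; apply: eq_bigr => k _.
    by rewrite /e /v; ring.
  apply: cvgB; last exact: cvgMr.
  by apply: cvgB; exact: cvg_pgf.
(* The terms of [e] at 0 and 1 vanish; dropping them leaves exponents of the form [n.+2], as the
   monomial bound requires. *)
rewrite -2!cvg_shiftS in e_cvg.
apply: cvg_norm_le e_cvg _ => n.
rewrite /series /= !big_nat_recl // {1 2}/e /= !expr0 !expr1 !mul0r !mul1r.
rewrite subrr subr0 mulr0 addrK subrr mulr0 !add0r.
rewrite (le_trans (ler_norm_sum _ _ _)) //.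
apply: (@le_trans _ _ ((s n)%:C * `|h| ^+ 2)); last first.
  by rewrite ler_wpM2r ?exprn_ge0 // lecR.
rewrite /s /pseries /series /= rmorph_sum mulr_suml ler_sum // => k _.
rewrite /e normrM norm_real_complex (ger0_norm (a_ge0 _)).
have := norm_exprDsub_le k yK hyK; rewrite addrK => kh.
rewrite (le_trans (ler_wpM2l _ kh)) ?lecR //.
rewrite /pseries_diffs !rmorphM /= !rmorph_nat rmorphXn natrM.
by rewrite le_eqVlt; apply/orP; left; apply/eqP; ring.
Qed.

Lemma derive1_pgf (a : nat -> R) (y : R[i]) : disc_series a -> `|y| < 1 ->
  ((pgf a)^`())%classic (y : C) = pgf (pseries_diffs a) y.
Proof.
move=> a_disc y_lt1; set L := pgf (pseries_diffs a) y.
have y01 : 0 <= complex.Re `|y| < 1.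
  by rewrite -lecR -ltcR -norm_complexE normr_ge0.
(* A radius strictly between the modulus of [y] and 1, so that [h + y] stays in the disc of radius
   [K] for small [h]. *)
pose K := (1 + complex.Re `|y|) / 2.
have [|M M_ge0 M_le] := @pgf_taylor1_le a K a_disc; first by rewrite /K; lra.
rewrite /derive1; apply: cvg_lim => //.
apply/cvgrPdist_le => eps eps_gt0.
have yK : `|y| < K%:C by rewrite norm_complexE ltcR /K; lra.
near=> h.
have h_neq0 : h != 0 by near: h; exact: nbhs_dnbhs_neq.
have hyK : `|h + y| <= K%:C.
  rewrite (le_trans (ler_normD _ _)) // -lerBrDr; near: h.
  by apply: dnbhs0_le; rewrite subr_gt0.
(* The denominator is [M + 1] because [M] may be zero. *)
have h_le : `|h| <= eps / (M + 1).
  by near: h; apply: dnbhs0_le; rewrite divr_gt0 // ltr_wpDl.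
have h_gt0 : 0 < `|h| by rewrite normr_gt0.
rewrite -(ler_pM2l h_gt0) -normrM mulrBr /= -[h^-1 *: _]/(h^-1 * _) mulVKf //.
rewrite distrC (le_trans (M_le _ _ (ltW yK) hyK)) // expr2 mulrCA.
rewrite ler_wpM2l // mulrC; apply: (@le_trans _ _ (`|h| * (M + 1))).
  by rewrite ler_wpM2l // lerDl.
by rewrite -ler_pdivlMr // ltr_wpDl.
Unshelve. all: end_near. Qed.

Lemma derive1n_pgf (a : nat -> R) (l : nat) (y : R[i]) :
  disc_series a -> `|y| < 1 ->
  ((pgf a)^`(l))%classic (y : C) = pgf (iter l (@pseries_diffs R) a) y.
Proof.
move=> a_disc; elim: l y => // l IHl y y_lt1.
have l_disc : disc_series (iter l (@pseries_diffs R) a).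
  by elim: l {IHl} => //= l; exact: disc_series_diffs.
rewrite derive1nS iterS -(derive1_pgf l_disc y_lt1) !derive1E.
apply: near_eq_derive.
(* The induction hypothesis holds only in the open unit disc. The ball of this radius around [y]
   stays inside it, and a derivative depends only on a neighbourhood. *)
have d_gt0 : 0 < 1 - `|y| by rewrite subr_gt0.
apply: filterS (nbhsx_ballx (y : C) _ d_gt0) => z yz; apply: IHl.
rewrite -[z](subrK y) (le_lt_trans (ler_normD _ _)) // -ltrBrDr distrC.
exact: yz.
Qed.

Lemma iter_pseries_diffs (a : nat -> R) (l k : nat) :
  iter l (@pseries_diffs R) a k = ((k + l) ^_ l)%:R * a (k + l)%N.
Proof.
elim: l k => [|l IHl] k; first by rewrite ffactn0 addn0 mul1r.
rewrite iterS /pseries_diffs IHl addSnnS mulrA -natrM; congr (_%:R * _).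
by rewrite -addSnnS ffactnSr addnK mulnC.
Qed.

(** Puts the Taylor coefficient in the form produced by the branching argument, where ['C(k, l)]
    counts the choices of [l] children among [k]. The terms with [k < l] vanish, so a shift by [l]
    gives the [l]-fold differentiated series. *)
Lemma cvg_derive1n_pgf (a : nat -> R) (l : nat) (y : R[i]) :
  disc_series a -> `|y| < 1 ->
  series (fun k => (a k)%:C * ('C(k, l)%:R * y ^+ (k - l)) : C) @ \oo -->
  (((pgf a)^`(l))%classic (y : C) / l`!%:R : C).
Proof.
move=> a_disc y_lt1; rewrite derive1n_pgf //.
set b := iter l _ a.
have b_disc : disc_series b.
  by rewrite /b; elim: (l) => //= m; exact: disc_series_diffs.
rewrite -(cvg_shiftn l) /=.
have -> : (fun n => series
      (fun k => (a k)%:C * ('C(k, l)%:R * y ^+ (k - l)) : C) (n + l)) =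
    (fun n => series (fun k => (b k)%:C * y ^+ k : C) n * (l`!%:R^-1 : C)).
  apply/funext => n; rewrite /series /= -[(n + l)%R]/(n + l)%N addnC.
  rewrite /index_iota subn0 iotaD add0n big_cat /=.
  rewrite big1_seq ?add0r; last first.
    move=> k /andP[_]; rewrite mem_iota add0n => /andP[_ lt_k].
    by rewrite bin_small // mul0r mulr0.
  rewrite subn0 mulr_suml -[X in iota X _]addn0 iotaDl big_map; apply: eq_bigr => k _.
  rewrite /b iter_pseries_diffs addKn rmorphM /= rmorph_nat addnC -bin_ffact natrM.
  have l_neq0 : (l`!%:R : R[i]) != 0 by rewrite pnatr_eq0 -lt0n fact_gt0.
  by field.
by apply: cvgMl; exact: cvg_pgf.
Qed.

End PowerSeries.

(** * Expectations of bounded complex random variables *)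

Section ComplexExpectation.
Context {R : realType} {d : measure_display} {Omega : measurableType d}.
Variable P : probability Omega R.
Local Notation C := (R[i]^o).
Local Notation "x %:C" := (real_complex R x).
Local Notation cE := (@cexpectation R d Omega P).

(** The bound 1 makes such variables integrable under a probability and keeps the class closed under
    products. *)
Definition unit_rv (Y : Omega -> R[i]) : Prop :=
  [/\ measurable_fun setT (fun w => complex.Re (Y w)),
      measurable_fun setT (fun w => complex.Im (Y w)) &
      forall w, `|Y w| <= 1].

Lemma integrable_norm_le1 (y : Omega -> R) : measurable_fun setT y ->
  (forall w, `|y w| <= 1) -> P.-integrable setT (fun w => (y w)%:E).
Proof.
move=> y_meas y_le1; apply: measurable_bounded_integrable => //.
  by rewrite (le_lt_trans (probability_le1 P measurableT)) // ltry.
by exists 1; split=> // M M_gt1 w _ /=; exact: le_trans (ltW M_gt1).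
Qed.

Lemma unit_rv_integrable (Y : Omega -> R[i]) : unit_rv Y ->
  P.-integrable setT (fun w => (complex.Re (Y w))%:E) /\
  P.-integrable setT (fun w => (complex.Im (Y w))%:E).
Proof.
move=> [Re_meas Im_meas Y_le1].
by split; apply: integrable_norm_le1 => // w;
  rewrite -lecR (le_trans _ (Y_le1 w)) // ?normc_ge_Re ?norm_Im_le.
Qed.

Lemma unit_rvM (Y Z : Omega -> R[i]) : unit_rv Y -> unit_rv Z ->
  unit_rv (fun w => Y w * Z w).
Proof.
move=> [ReY ImY Y_le1] [ReZ ImZ Z_le1]; split=> [||w].
- under eq_fun do rewrite complex_ReM.
  by apply: measurable_funB; apply: measurable_funM.
- under eq_fun do rewrite complex_ImM.
  by apply: measurable_funD; apply: measurable_funM.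
- by rewrite normrM mulr_ile1.
Qed.

Lemma measurable_nat_comp (X : Omega -> nat) (g : nat -> R) :
  measurable_fun setT X -> measurable_fun setT (fun w => g (X w)).
Proof.
move=> X_meas.
have g_meas : measurable_fun [set: nat] g by [].
exact: (measurableT_comp g_meas X_meas).
Qed.

Lemma unit_rv_comp (X : Omega -> nat) (g : nat -> R[i]) :
  measurable_fun setT X -> (forall v, `|g v| <= 1) -> unit_rv (fun w => g (X w)).
Proof.
move=> X_meas g_le1; split=> // _.
- exact: (measurable_nat_comp (fun v => complex.Re (g v))).
- exact: (measurable_nat_comp (fun v => complex.Im (g v))).
Qed.

Lemma unit_rv_bool (X : Omega -> nat) (b : nat -> bool) :
  measurable_fun setT X -> unit_rv (fun w => (b (X w))%:R).
Proof.
move=> X_meas; apply: (unit_rv_comp (g := fun v => (b v)%:R)) => // v.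
by case: (b v); rewrite ?normr1 ?normr0 ?ler01.
Qed.

Lemma unit_rv_prod (k : nat) (Y : 'I_k -> Omega -> R[i]) :
  (forall i, unit_rv (Y i)) -> unit_rv (fun w => \prod_(i < k) Y i w).
Proof.
elim: k Y => [|k IHk] Y Y_unit.
  under eq_fun do rewrite big_ord0.
  by split=> [||w]; rewrite ?normr1.
under eq_fun do rewrite big_ord_recr.
by apply: unit_rvM => //; exact: IHk.
Qed.

Lemma cexpectationE (Y : Omega -> R[i]) :
  cE Y = Complex (\int[P]_w complex.Re (Y w)) (\int[P]_w complex.Im (Y w)).
Proof. by rewrite /cexpectation !unlock. Qed.

Lemma cexpectationZ (c : R[i]) (Y : Omega -> R[i]) : unit_rv Y ->
  cE (fun w => c * Y w) = c * cE Y.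
Proof.
move=> Y_unit; have [ReY ImY] := unit_rv_integrable Y_unit.
have intZ (r : R) (y : Omega -> R) : P.-integrable setT (EFin \o y) ->
  P.-integrable setT (EFin \o (fun w => r * y w)).
  by move=> /(integrableZl measurableT r); apply: eq_integrable.
rewrite !cexpectationE; apply/eqP.
rewrite eq_complex complex_ReM complex_ImM /=; apply/andP; split; apply/eqP.
- under eq_Rintegral do rewrite complex_ReM.
  by rewrite RintegralB ?RintegralZl //; exact: intZ.
- under eq_Rintegral do rewrite complex_ImM.
  by rewrite RintegralD ?RintegralZl //; exact: intZ.
Qed.

Lemma cexpectation_sum (I : finType) (Q : pred I) (Y : I -> Omega -> R[i]) :
  (forall i, unit_rv (Y i)) ->
  cE (fun w => \sum_(i | Q i) Y i w) = \sum_(i | Q i) cE (Y i).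
Proof.
move=> Y_unit.
have int_sum (y : I -> Omega -> R) :
    (forall i, P.-integrable setT (fun w => (y i w)%:E)) ->
    \int[P]_w (\sum_(i | Q i) y i w) = \sum_(i | Q i) \int[P]_w y i w.
  move=> y_int; rewrite /Rintegral.
  under eq_integral do rewrite -sumEFin.
  rewrite integral_sum // -sum_fine // => i _; exact: integrable_fin_num.
apply/eqP; rewrite eq_complex !raddf_sum; apply/andP; split; apply/eqP.
- rewrite cexpectationE [LHS]/=; under eq_Rintegral do rewrite raddf_sum.
  rewrite int_sum => [|i]; last by have [] := unit_rv_integrable (Y_unit i).
  by apply: eq_bigr => i _; rewrite cexpectationE.
- rewrite cexpectationE [LHS]/=; under eq_Rintegral do rewrite raddf_sum.
  rewrite int_sum => [|i]; last by have [] := unit_rv_integrable (Y_unit i).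
  by apply: eq_bigr => i _; rewrite cexpectationE.
Qed.

Lemma cexpectation_bool (b : Omega -> bool) :
  measurable [set w | b w] ->
  cE (fun w => (b w)%:R) = (fine (P [set w | b w]))%:C.
Proof.
move=> b_meas; rewrite cexpectationE.
have -> : (fun w => complex.Re ((b w)%:R : R[i])) = \1_[set w | b w].
  apply/funext => w; rewrite indicE -(rmorph_nat (real_complex R)) /=.
  by congr (nat_of_bool _)%:R; apply/idP/idP => [/mem_set|/set_mem].
have -> : (fun w => complex.Im ((b w)%:R : R[i])) = fun=> 0.
  by apply/funext => w; rewrite -(rmorph_nat (real_complex R)).
by rewrite Rintegral_cst // mul0r /Rintegral integral_indic // setIT.
Qed.

(** The partial sums are integrals of [y] over the events [X < n]; at each point the integrand is
    eventually constant, and dominated convergence applies with bound 1. *)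
Lemma Rintegral_series (X : Omega -> nat) (y : Omega -> R) :
  measurable_fun setT X -> measurable_fun setT y -> (forall w, `|y w| <= 1) ->
  series (fun v => \int[P]_w (y w * (X w == v)%:R)) @ \oo --> \int[P]_w y w.
Proof.
move=> X_meas y_meas y_le1.
have b_meas (b : nat -> bool) : measurable_fun setT (fun w => (b (X w))%:R : R).
  exact: (measurable_nat_comp (fun v => (b v)%:R)).
have yb_meas (b : nat -> bool) : measurable_fun setT (fun w => y w * (b (X w))%:R).
  exact: measurable_funM.
have yb_le (b : nat -> bool) w : `|y w * (b (X w))%:R| <= 1.
  by rewrite normrM normr_nat mulr_ile1 // lern1 leq_b1.
have -> : series (fun v => \int[P]_w (y w * (X w == v)%:R)) =
    fun n => \int[P]_w (y w * (X w < n)%N%:R).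
  apply/funext; elim=> [|n IHn].
    rewrite /series /= big_nil; under eq_Rintegral do rewrite mulr0.
    by rewrite Rintegral_cst // mul0r.
  rewrite seriesSr IHn -RintegralD //;
    [|exact: (integrable_norm_le1 (yb_meas (fun x => (x < n)%N)) (yb_le _))
     |exact: (integrable_norm_le1 (yb_meas (fun x => x == n)) (yb_le _))].
  apply: eq_Rintegral => w _; rewrite -mulrDr -natrD [in RHS]ltnS [in RHS]leq_eqVlt.
  by congr (_ * _%:R); case: (ltngtP (X w) n).
apply: fine_cvg; rewrite fineK; last first.
  by apply: integrable_fin_num => //; exact: integrable_norm_le1.
apply: (@dominated_cvg _ _ _ P setT measurableT
  (fun n w => (y w * (X w < n)%N%:R)%:E) (fun w => (y w)%:E) (cst 1%E)) => //=.
- by move=> n; apply/measurable_EFinP; exact: (yb_meas (fun x => (x < n)%N)).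
- move=> w _; apply: cvg_EFin; first exact: nearW.
  apply: cvg_near_cst; near=> n; rewrite /=.
  by rewrite (_ : (X w < n)%N) ?mulr1 //; near: n; exact: nbhs_infty_gt.
- by apply: (@integrable_norm_le1 (cst 1)) => // w; rewrite normr1.
- by move=> n w _; rewrite lee_fin; exact: (yb_le (fun x => (x < n)%N)).
Unshelve. all: end_near. Qed.

(** Law of total expectation over the values of a discrete variable, used for the offspring number
    of the ancestor and for tree codes. *)
Lemma cexpectation_series (X : Omega -> nat) (Y : Omega -> R[i]) :
  measurable_fun setT X -> unit_rv Y ->
  series (fun v => cE (fun w => Y w * (X w == v)%:R) : C) @ \oo --> (cE Y : C).
Proof.
move=> X_meas Y_unit; have [ReY ImY Y_le1] := Y_unit.
have Re_le w : `|complex.Re (Y w)| <= 1.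
  by rewrite -lecR (le_trans (normc_ge_Re _)).
have Im_le w : `|complex.Im (Y w)| <= 1.
  by rewrite -lecR (le_trans (norm_Im_le _)).
have sRe n : complex.Re (series (fun v => cE (fun w => Y w * (X w == v)%:R)) n) =
    series (fun v => \int[P]_w (complex.Re (Y w) * (X w == v)%:R)) n.
  rewrite /series /= raddf_sum; apply: eq_bigr => v _; rewrite cexpectationE /=.
  apply: eq_Rintegral => w _.
  by rewrite -(rmorph_nat (real_complex R)) complex_ReM mulr0 subr0.
have sIm n : complex.Im (series (fun v => cE (fun w => Y w * (X w == v)%:R)) n) =
    series (fun v => \int[P]_w (complex.Im (Y w) * (X w == v)%:R)) n.
  rewrite /series /= raddf_sum; apply: eq_bigr => v _; rewrite cexpectationE /=.
  apply: eq_Rintegral => w _.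
  by rewrite -(rmorph_nat (real_complex R)) complex_ImM mulr0 add0r.
rewrite [cE Y]cexpectationE; apply: cvg_complex => /=.
- by under eq_fun do rewrite sRe; exact: Rintegral_series.
- by under eq_fun do rewrite sIm; exact: Rintegral_series.
Qed.

End ComplexExpectation.

(** * Laws of discrete variables and product formulas *)

Section Independence.
Context {R : realType} {d : measure_display} {Omega : measurableType d}.
Variable P : probability Omega R.
Local Notation C := (R[i]^o).
Local Notation "x %:C" := (real_complex R x).
Local Notation cE := (@cexpectation R d Omega P).

Lemma norm_bool_le1 (b : bool) : `|b%:R : R[i]| <= 1.
Proof. by rewrite normr_nat lern1 leq_b1. Qed.

Lemma cexpectation_fiber (X : Omega -> nat) (g : nat -> R[i]) (v : nat) :
  measurable_fun setT X ->
  cE (fun w => g (X w) * (X w == v)%:R) = g v * cE (fun w => (X w == v)%:R).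
Proof.
move=> X_meas; rewrite -cexpectationZ; last first.
  exact: (unit_rv_bool (fun x => x == v)).
congr cexpectation; apply/funext => w.
by have [->|] := eqVneq (X w) v; rewrite ?mulr0.
Qed.

Lemma cexpectation_law (X : Omega -> nat) (g : nat -> R[i]) :
  measurable_fun setT X -> (forall v, `|g v| <= 1) ->
  series (fun v => g v * cE (fun w => (X w == v)%:R) : C) @ \oo -->
  (cE (fun w => g (X w)) : C).
Proof.
move=> X_meas g_le1.
suff -> : (fun v => g v * cE (fun w => (X w == v)%:R)) =
    (fun v => cE (fun w => g (X w) * (X w == v)%:R)).
  exact: cexpectation_series X_meas (unit_rv_comp X_meas g_le1).
by apply/funext => v; rewrite (cexpectation_fiber g).
Qed.

(** Both expectations are the sum of the same series, determined by the probabilities of the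
    atoms. *)
Lemma eq_cexpectation_law (X Y : Omega -> nat) (g : nat -> R[i]) :
  measurable_fun setT X -> measurable_fun setT Y -> (forall v, `|g v| <= 1) ->
  (forall v, cE (fun w => (X w == v)%:R) = cE (fun w => (Y w == v)%:R)) ->
  cE (fun w => g (X w)) = cE (fun w => g (Y w)).
Proof.
move=> X_meas Y_meas g_le1 XY.
have := cexpectation_law X_meas g_le1; under eq_fun do rewrite XY.
move=> X_lim; have Y_lim := cexpectation_law Y_meas g_le1.
exact: (cvg_unique (@norm_hausdorff _ _) X_lim Y_lim).
Qed.

(* Atoms are replaced by arbitrary functions one coordinate at a time, by
   summing over the values of that coordinate. *)
Lemma cexpectation_prod (k : nat) (X : 'I_k -> Omega -> nat)
    (Z : Omega -> R[i]) (q : R[i]) :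
  (forall i, measurable_fun setT (X i)) -> unit_rv Z ->
  (forall t : 'I_k -> nat,
     cE (fun w => \prod_(i < k) (X i w == t i)%:R * Z w) =
     q * \prod_(i < k) cE (fun w => (X i w == t i)%:R)) ->
  forall g : 'I_k -> nat -> R[i], (forall i v, `|g i v| <= 1) ->
  cE (fun w => \prod_(i < k) g i (X i w) * Z w) =
  q * \prod_(i < k) cE (fun w => g i (X i w)).
Proof.
move=> X_meas Z_unit atoms.
(* Coordinates below [m] carry arbitrary functions, those from [m] on are still indicators of single
   values; [m = 0] is the hypothesis and [m = k] the claim. *)
suff main m : forall g : 'I_k -> nat -> R[i], (forall i v, `|g i v| <= 1) ->
    (forall i : 'I_k, (m <= i)%N -> exists t, forall v, g i v = (v == t)%:R) ->
    cE (fun w => \prod_(i < k) g i (X i w) * Z w) =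
    q * \prod_(i < k) cE (fun w => g i (X i w)).
  by move=> g g_le1; apply: (main k) => // i; rewrite leqNgt ltn_ord.
elim: m => [|m IHm] g g_le1 g_atom.
  have [t t_g] := choice (fun i => g_atom i (leq0n i)).
  under eq_fun do under eq_bigr do rewrite t_g.
  rewrite atoms; congr (_ * _); apply: eq_bigr => i _.
  by congr cexpectation; apply/funext => w; rewrite t_g.
have [lt_mk|le_km] := ltnP m k; last first.
  by apply: IHm => // i le_mi; have := leq_trans le_km le_mi; rewrite leqNgt ltn_ord.
pose i0 := Ordinal lt_mk.
(* [g' v] puts the indicator of [v] back at the coordinate [i0], which brings the product under the
   induction hypothesis. *)
pose g' v i x : R[i] := if i == i0 then (x == v)%:R else g i x.
have g'_le1 v i x : `|g' v i x| <= 1.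
  by rewrite /g'; case: eqP => // _; exact: norm_bool_le1.
have g_unit h : (forall i v, `|h i v| <= 1) ->
    unit_rv (fun w => \prod_(i < k) h i (X i w) * Z w).
  move=> h_le1; apply: unit_rvM => //; apply: unit_rv_prod => i.
  exact: unit_rv_comp.
have IH v : cE (fun w => \prod_(i < k) g' v i (X i w) * Z w) =
    q * \prod_(i < k) cE (fun w => g' v i (X i w)).
  apply: IHm => // i; rewrite leq_eqVlt => /predU1P[mi|lt_mi].
    by exists v => x; rewrite /g' (_ : i == i0) //; exact/eqP/val_inj.
  have [t t_g] := g_atom i lt_mi; exists t => x.
  by rewrite /g' (_ : (i == i0) = false) ?t_g // -val_eqE gtn_eqF.
have lhs := @cexpectation_series _ _ _ P _ _ (X_meas i0) (g_unit g g_le1).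
set r := q * \prod_(i < k | i != i0) cE (fun w => g i (X i w)).
have rhs : series (fun v => r * (g i0 v * cE (fun w => (X i0 w == v)%:R)) : C) @ \oo
    --> (r * cE (fun w => g i0 (X i0 w)) : C).
  have -> : series (fun v => r * (g i0 v * cE (fun w => (X i0 w == v)%:R)) : C) =
    fun n => r * series (fun v => g i0 v * cE (fun w => (X i0 w == v)%:R) : C) n.
    by apply/funext => n; rewrite /series /= mulr_sumr.
  by apply: cvgMr; exact: cexpectation_law.
have -> : q * \prod_(i < k) cE (fun w => g i (X i w)) =
    r * cE (fun w => g i0 (X i0 w)).
  by rewrite (bigD1 i0) //= /r; ring.
suff E : (fun v => r * (g i0 v * cE (fun w => (X i0 w == v)%:R))) =
    (fun v => cE (fun w => \prod_(i < k) g i (X i w) * Z w * (X i0 w == v)%:R)).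
  by rewrite E in rhs; exact: (cvg_unique (@norm_hausdorff _ _) lhs rhs).
apply/esym; apply/funext => v.
transitivity (g i0 v * (q * \prod_(i < k) cE (fun w => g' v i (X i w)))).
  rewrite -IH -cexpectationZ; last exact: g_unit.
  congr cexpectation; apply/funext => w.
  rewrite (bigD1 i0) // [in RHS](bigD1 i0) //= {1}/g' eqxx.
  have -> : \prod_(i < k | i != i0) g' v i (X i w) =
      \prod_(i < k | i != i0) g i (X i w).
    by apply: eq_bigr => i /negPf ne_i; rewrite /g' ne_i.
  by have [->|] := eqVneq (X i0 w) v; rewrite ?mulr0 ?mul0r ?mulr0 // mulr1 mul1r mulrA.
rewrite (bigD1 i0) //= {1}/g' eqxx.
have -> : \prod_(i < k | i != i0) cE (fun w => g' v i (X i w)) =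
    \prod_(i < k | i != i0) cE (fun w => g i (X i w)).
  apply: eq_bigr => i /negPf ne_i; congr cexpectation; apply/funext => w.
  by rewrite /g' ne_i.
by rewrite /r; ring.
Qed.

End Independence.

(** * The branching process *)

Section TreeLaw.
Context {R : realType} {d : measure_display} {Omega : measurableType d}.
Variable P : probability Omega R.
Variables (p : nat -> R) (xi : seq nat -> {RV P >-> nat}).
Hypothesis hxi : galton_watson p xi.
Local Notation C := (R[i]^o).
Local Notation "x %:C" := (real_complex R x).
Local Notation cE := (@cexpectation R d Omega P).

Definition tree_rv (n : nat) (u : seq nat) (w : Omega) : nat :=
  tree_code (fun v => xi v w) n u.

Lemma measurable_fibers (X : Omega -> nat) :
  (forall v, measurable [set w | X w = v]) -> measurable_fun setT X.
Proof.
move=> X_fib _ B _; rewrite setTI.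
have -> : X @^-1` B = \bigcup_(v in B) [set w | X w = v].
  by apply/seteqP; split=> [w Xw|w [v Bv /= Xv]]; [exists (X w)|rewrite /= Xv].
exact: bigcup_measurable.
Qed.

Lemma measurable_offspring (u : seq nat) : measurable_fun setT (xi u).
Proof. exact: measurable_funPT. Qed.

Lemma measurable_eq (X : Omega -> nat) (v : nat) :
  measurable_fun setT X -> measurable [set w | X w = v].
Proof.
move=> X_meas; rewrite -[X in measurable X]setTI.
exact: (X_meas measurableT [set v]).
Qed.

Lemma measurable_tree_rv (n : nat) (u : seq nat) :
  measurable_fun setT (tree_rv n u).
Proof.
elim: n u => [|n IHn] u; apply: measurable_fibers => t.
  exact: measurable_eq (measurable_cst 0%N).
have -> : [set w | tree_rv n.+1 u w = t] =
    [set w | xi u w = size (CodeSeq.decode t)] `&`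
    \bigcap_(i in `I_(size (CodeSeq.decode t)))
      [set w | tree_rv n (rcons u i) w = nth 0%N (CodeSeq.decode t) i].
  by apply/seteqP; split=> w; [move/tree_code_eq|move=> h; apply/tree_code_eq].
apply: measurableI; first exact: measurable_eq (measurable_offspring u).
by apply: bigcap_measurableType => i _; exact: measurable_eq.
Qed.

(** For a valid code the event fixes the offspring numbers of finitely many distinct nodes, so
    independence gives the product of their probabilities; an invalid code is never attained. *)
Lemma tree_law (n : nat) (u : seq nat) (t : nat) :
  P [set w | tree_rv n u w == t] = (code_weight p n t)%:E.
Proof.
have [t_valid|t_invalid] := boolP (code_valid n t); last first.
  rewrite code_weight_invalid // (_ : [set w | _] = set0) ?measure0 //.
  rewrite -subset0 => w /= /eqP tE; move: t_invalid; rewrite -tE.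
  by rewrite tree_code_valid.
set L := code_labels n u t.
(* For a labelled node [v] this is the singleton of its prescribed offspring number, because labels
   do not repeat. *)
pose B v := [set c | (v, c) \in L].
have L_uniq : uniq [seq vc.1 | vc <- L] by exact: uniq_code_labels.
have B1 vc : vc \in L -> B vc.1 = [set vc.2].
  move=> vc_in; apply/seteqP; split=> [c /= c_in|c /= ->]; last by case: vc vc_in.
  have := perm_to_rem vc_in => L_perm.
  have /= := perm_uniq (perm_map (fun vc => vc.1) L_perm); rewrite L_uniq.
  move=> /esym /andP[vc_notin _].
  have : (vc.1, c) \in L by exact: c_in.
  rewrite (perm_mem L_perm) inE => /predU1P[/(congr1 snd) //|c_rem].
  by move: vc_notin => /negP[]; apply/mapP; exists (vc.1, c).
have -> : [set w | tree_rv n u w == t] =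
    \bigcap_(v in [set` [seq vc.1 | vc <- L]]) xi v @^-1` B v.
  apply/seteqP; split=> w /=.
    move=> /eqP /(code_labelsP _ _ t_valid) w_L _ /mapP[vc vc_in ->].
    by rewrite B1 //=; exact: w_L.
  move=> w_L; apply/eqP/code_labelsP => // vc vc_in.
  by have := w_L vc.1 (map_f _ vc_in); rewrite /= B1.
have [law indep] := hxi; rewrite indep // big_map.
rewrite -(prod_code_labels _ u t_valid) -prodEFin; apply: eq_big_seq => vc vc_in.
by rewrite B1 // law.
Qed.

Lemma cexpectation_tree (n : nat) (u : seq nat) (t : nat) :
  cE (fun w => (tree_rv n u w == t)%:R) = (code_weight p n t)%:C.
Proof.
rewrite (@cexpectation_bool _ _ _ P (fun w => tree_rv n u w == t)) ?tree_law //.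
rewrite (_ : [set w | _] = [set w | tree_rv n u w = t]).
  exact: measurable_eq (measurable_tree_rv n u).
by apply/seteqP; split=> w /eqP.
Qed.

Lemma prod_bool (k : nat) (b : 'I_k -> bool) :
  \prod_(i < k) (b i)%:R = [forall i, b i]%:R :> R[i].
Proof.
have [/forallP b_all|] := boolP [forall i, b i].
  by rewrite big1 // => i _; rewrite b_all.
rewrite negb_forall => /existsP[i /negPf bi]; rewrite (bigD1 i) //= bi.
by rewrite mul0r.
Qed.

(** For indicators of single codes, fixing [k] and the [k] subtrees fixes one tree of height [n.+1],
    whose weight factorizes; [cexpectation_prod] then passes to general functions. Since [xi] is
    indexed by all words, the subtree at [[:: i]] makes sense even when [i] is not born. *)
Lemma branching_property (n k : nat) (g : 'I_k -> nat -> R[i]) :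
  (forall i v, `|g i v| <= 1) ->
  cE (fun w => \prod_(i < k) g i (tree_rv n [:: i : nat] w) * (xi [::] w == k)%:R) =
  (p k)%:C * \prod_(i < k) cE (fun w => g i (tree_rv n [::] w)).
Proof.
move=> g_le1; transitivity ((p k)%:C *
  \prod_(i < k) cE (fun w => g i (tree_rv n [:: i : nat] w))).
  apply: (cexpectation_prod (X := fun i w => tree_rv n [:: i : nat] w)) => //.
  - by move=> i; exact: measurable_tree_rv.
  - exact: (unit_rv_bool (fun x => x == k) (measurable_offspring [::])).
  move=> t; under [in RHS]eq_bigr do rewrite cexpectation_tree.
  pose T := CodeSeq.code [seq t i | i <- enum 'I_k].
  have -> : (p k)%:C * \prod_(i < k) (code_weight p n (t i))%:C =
      (code_weight p n.+1 T)%:C.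
    rewrite /= CodeSeq.codeK size_map size_enum_ord rmorphM rmorph_prod /=.
    by rewrite big_map big_enum.
  rewrite -(cexpectation_tree n.+1 [::]); congr cexpectation; apply/funext => w.
  rewrite prod_bool -natrM mulnb; congr (nat_of_bool _)%:R.
  apply/andP/eqP => [[/forallP w_t /eqP w_k]|/tree_code_eq].
    apply/tree_code_eq; rewrite CodeSeq.codeK size_map size_enum_ord; split=> // i lt_i.
    rewrite (nth_map (Ordinal lt_i)) ?size_enum_ord //.
    by rewrite (nth_ord_enum _ (Ordinal lt_i)); exact/eqP/(w_t (Ordinal lt_i)).
  rewrite CodeSeq.codeK size_map size_enum_ord => -[w_k w_t]; split; last exact/eqP.
  apply/forallP => i; apply/eqP.
  rewrite -[LHS]/(tree_code _ n (rcons [::] (i : nat))) w_t //.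
  by rewrite (nth_map i) ?size_enum_ord // nth_ord_enum.
(* The law of a truncated subtree does not depend on its root, so the node [[:: i]] may be replaced
   by the ancestor. *)
congr (_ * _); apply: eq_bigr => i _; apply: eq_cexpectation_law => //.
- exact: measurable_tree_rv.
- exact: measurable_tree_rv.
- by move=> v; rewrite !cexpectation_tree.
Qed.

End TreeLaw.

(** Sets are grouped by cardinality [l]: the quotient by [N] equals [j] exactly for [l] from [j * N]
    to [j * N + N - 1], and there are ['C(k, l)] sets of each size. *)
Lemma sum_sets_card (K : nzRingType) (k N j : nat) (F : nat -> K) : (0 < N)%N ->
  \sum_(D : {set 'I_k} | (#|D| %/ N)%N == j) F #|D| =
  \sum_(j * N <= l < j * N + N) 'C(k, l)%:R * F l.
Proof.
move=> N_gt0; transitivity (\sum_(j * N <= l < j * N + N)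
    \sum_(D : {set 'I_k} | #|D| == l) F #|D|); last first.
  apply: eq_bigr => l _; rewrite (eq_bigr (fun=> F l)) => [|D /eqP ->//].
  by rewrite sumr_const -cardsE card_draws card_ord mulr_natl.
rewrite (exchange_big_dep xpredT) //= big_mkcond; apply: eq_bigr => D _.
under [RHS]eq_bigl do rewrite eq_sym.
rewrite big_nat1_eq; congr (if _ then _ else _).
by rewrite eqn_leq leq_divRL // -ltnS ltn_divLR // mulSn addnC andbC.
Qed.

(** * Recursion for the generating functions *)

Section Offspring.
Context {R : realType} {d : measure_display} {Omega : measurableType d}.
Variable P : probability Omega R.
Variables (p : nat -> R) (xi : seq nat -> {RV P >-> nat}) (N : nat).
Hypothesis N_gt0 : (0 < N)%N.
Hypothesis p_ge0 : forall k, 0 <= p k.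
Hypothesis hxi : galton_watson p xi.
Local Notation C := (R[i]^o).
Local Notation "x %:C" := (real_complex R x).
Local Notation cE := (@cexpectation R d Omega P).

Lemma V_code (n : nat) (w : Omega) :
  V xi N n.+1 w = code_subtrees N n.+1 (tree_rv xi n.+1 [::] w).
Proof. exact: num_disjoint_subtrees_code. Qed.

Lemma nu_code (n : nat) (w : Omega) :
  nu xi n w = code_size n (tree_rv xi n [::] w).
Proof. exact: total_progeny_code. Qed.

Lemma code_subtrees_gt0 (n t : nat) :
  (0 < code_subtrees N n.+1 t)%N = code_good N n.+1 t.
Proof. by rewrite /code_subtrees divn_gt0. Qed.

Lemma code_weight_ge0 (n t : nat) : 0 <= code_weight p n t.
Proof.
elim: n t => [|n IHn] t /=; first exact: ler0n.
by rewrite mulr_ge0 // prodr_ge0.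
Qed.

(** The weights are the probabilities of the values of [tree_rv]; they sum to 1 and partial sums of
    nonnegative terms stay below the limit. *)
Lemma sum_code_weight_le1 (n m : nat) : \sum_(0 <= t < m) code_weight p n t <= 1.
Proof.
have weightE t : \int[P]_w (1 * (tree_rv xi n [::] w == t)%:R) = code_weight p n t.
  have := cexpectation_tree hxi n [::] t.
  rewrite cexpectationE => /(congr1 (@complex.Re R)) /= <-.
  by apply: eq_Rintegral => w _; rewrite mul1r -(rmorph_nat (real_complex R)).
have one_le1 (w : Omega) : `|cst 1 w : R| <= 1 by rewrite normr1.
have := @Rintegral_series _ _ _ P _ _ (measurable_tree_rv xi n [::])
  (measurable_cst _) one_le1.
under eq_fun do rewrite weightE.
rewrite /= Rintegral_cst // [X in 1 * X](_ : _ = 1); last first.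
  exact: (congr1 fine (probability_setT P)).
rewrite mul1r => sum1.
have weight_nd : nondecreasing_seq (series (code_weight p n)).
  by apply: nondecreasing_series => t _ _; exact: code_weight_ge0.
have weight_cvg : cvgn (series (code_weight p n)) by apply/cvg_ex; exists 1.
have := nondecreasing_cvgn_le weight_nd weight_cvg m.
by rewrite (cvg_lim (@Rhausdorff R) sum1).
Qed.

Section Generating.
Variable s : R[i].
Hypothesis s_le1 : `|s| <= 1.

(** The integrand of psi for [b = true] and of phi for [b = false], as a function of the code. *)
Definition code_value (b : bool) (n t : nat) : R[i] :=
  s ^+ code_size n t * (code_good N n t == b)%:R.

Lemma norm_code_value (b : bool) (n t : nat) : `|code_value b n t| <= 1.
Proof. by rewrite normrM normrX mulr_ile1 ?exprn_ile1 // norm_bool_le1. Qed.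

Lemma psi_code (n : nat) :
  psi xi N n.+1 s = cE (fun w => code_value true n.+1 (tree_rv xi n.+1 [::] w)).
Proof.
congr cexpectation; apply/funext => w; rewrite /code_value -nu_code; congr (_ * _).
rewrite indicE -code_subtrees_gt0 -V_code; congr (nat_of_bool _)%:R.
by apply/idP/eqP => [/set_mem|/mem_set].
Qed.

Lemma phi_code (n : nat) :
  phi xi N n.+1 s = cE (fun w => code_value false n.+1 (tree_rv xi n.+1 [::] w)).
Proof.
congr cexpectation; apply/funext => w; rewrite /code_value -nu_code; congr (_ * _).
rewrite indicE -code_subtrees_gt0 -V_code; congr (nat_of_bool _)%:R.
apply/idP/eqP => [/set_mem /= ->//|]; rewrite lt0n => /negbFE/eqP V0.
exact: mem_set.
Qed.

(** The complete [k]-ary tree has positive probability and contains a complete [N]-ary subtree, so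
    its mass is missing from phi. *)
Lemma norm_phi_lt1 (n k : nat) : (N <= k)%N -> 0 < p k ->
  `|phi xi N n.+1 s| < 1.
Proof.
move=> le_Nk pk_gt0; set t0 := full_code k n.+1.
have q_gt0 : 0 < code_weight p n.+1 t0.
  by have [m ->] := code_weight_full p k n.+1; exact: exprn_gt0.
apply: (@le_lt_trans _ _ (1 - code_weight p n.+1 t0)%:C); last first.
  by rewrite ltcR ltrBlDr ltrDl.
have := @cexpectation_law _ _ _ P _ _ (measurable_tree_rv xi n.+1 [::])
  (norm_code_value false n.+1).
(* After this shift every partial sum includes the index [t0], whose term is zero. *)
rewrite -phi_code -(cvg_shiftn t0.+1) => phi_lim.
apply: (cvg_norm_le phi_lim) => m; rewrite /series /= big_mkord.
have lt_t0 : (t0 < m + t0.+1)%N by rewrite addnS ltnS leq_addl.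
rewrite (bigD1 (Ordinal lt_t0)) //= {1}/code_value code_good_full //= mulr0 mul0r add0r.
rewrite (le_trans (ler_norm_sum _ _ _)) //.
apply: (@le_trans _ _
  (\sum_(i < m + t0.+1 | i != Ordinal lt_t0) (code_weight p n.+1 i)%:C)).
  apply: ler_sum => i _; rewrite normrM (cexpectation_tree hxi).
  rewrite norm_real_complex (ger0_norm (code_weight_ge0 _ _)).
  by rewrite ler_piMl ?norm_code_value // lecR code_weight_ge0.
rewrite -rmorph_sum lecR lerBrDl.
have := sum_code_weight_le1 n.+1 (m + t0.+1).
by rewrite big_mkord (bigD1 (Ordinal lt_t0)).
Qed.

(** The product vanishes unless [D] is exactly the set of indices carrying a good subtree. *)
Lemma prod_code_value (n k : nat) (X : 'I_k -> nat) (D : {set 'I_k}) :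
  \prod_(i < k) code_value (i \in D) n (X i) =
  s ^+ (\sum_(i < k) code_size n (X i)) *
  (D == finset (fun i => code_good N n (X i)))%:R.
Proof.
rewrite big_split /= prodrXr prod_bool; congr (_ * (nat_of_bool _)%:R).
apply/forallP/eqP => [goodD|-> i]; last by rewrite inE.
by apply/setP => i; rewrite inE (eqP (goodD i)).
Qed.

Lemma code_value_decomposition (n k j : nat) (w : Omega) :
  s ^+ code_size n.+1 (tree_rv xi n.+1 [::] w) *
    (code_subtrees N n.+1 (tree_rv xi n.+1 [::] w) == j)%:R * (xi [::] w == k)%:R =
  \sum_(D : {set 'I_k} | (#|D| %/ N)%N == j)
    s * (\prod_(i < k) code_value (i \in D) n (tree_rv xi n [:: i : nat] w) *
         (xi [::] w == k)%:R).
Proof.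
have [k_eq|_] := eqVneq (xi [::] w) k; last first.
  by rewrite mulr0 big1 // => D _; rewrite !mulr0.
rewrite mulr1; under eq_bigr do rewrite mulr1 prod_code_value.
rewrite -mulr_sumr -mulr_sumr.
set D0 := finset _.
have -> : \sum_(D : {set 'I_k} | (#|D| %/ N)%N == j) (D == D0)%:R =
    ((#|D0| %/ N)%N == j)%:R :> R[i].
  rewrite big_mkcond (bigD1 D0) //= eqxx big1 ?addr0 => [|D /negPf ->].
    by case: eqP.
  by case: ifP.
have T_decode : CodeSeq.decode (tree_rv xi n.+1 [::] w) =
    [seq tree_rv xi n [:: i] w | i <- index_iota 0 k].
  by rewrite /tree_rv /= CodeSeq.codeK k_eq /index_iota subn0.
(* The extra factor [s] accounts for the ancestor in the total progeny. *)
rewrite mulrA -exprS /code_subtrees [code_size _ _]/= T_decode big_map big_mkord.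
congr (_ * (nat_of_bool ((_ %/ _)%N == _))%:R).
rewrite count_map -sum1_count big_mkord sum1dep_card -cardsE.
by apply: eq_card => i; rewrite !inE.
Qed.

(** Given [k] children, each set [D] of good ones contributes psi to the power of its size times phi
    to the power of the size of its complement, by the branching property. *)
Lemma cexpectation_generation (n k j : nat) :
  cE (fun w => s ^+ nu xi n.+2 w * (V xi N n.+2 w == j)%:R * (xi [::] w == k)%:R) =
  s * \sum_(j * N <= l < j * N + N)
    psi xi N n.+1 s ^+ l *
      ((p k)%:C * ('C(k, l)%:R * phi xi N n.+1 s ^+ (k - l))).
Proof.
transitivity (\sum_(D : {set 'I_k} | (#|D| %/ N)%N == j)
    s * ((p k)%:C * (psi xi N n.+1 s ^+ #|D| * phi xi N n.+1 s ^+ (k - #|D|)))).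
  transitivity (cE (fun w => \sum_(D : {set 'I_k} | (#|D| %/ N)%N == j)
      s * (\prod_(i < k) code_value (i \in D) n.+1 (tree_rv xi n.+1 [:: i : nat] w) *
         (xi [::] w == k)%:R))).
    congr cexpectation; apply/funext => w.
    by rewrite -code_value_decomposition nu_code V_code.
  have D_unit (D : {set 'I_k}) : unit_rv (fun w =>
      \prod_(i < k) code_value (i \in D) n.+1 (tree_rv xi n.+1 [:: i : nat] w) *
         (xi [::] w == k)%:R).
    apply: unit_rvM.
      apply: unit_rv_prod => i; apply: unit_rv_comp (norm_code_value _ _).
      exact: measurable_tree_rv.
    exact: (unit_rv_bool (fun x => x == k) (measurable_offspring xi [::])).
  rewrite cexpectation_sum => [|D]; last first.
    by apply: unit_rvM (D_unit D); split.
  apply: eq_bigr => D _; rewrite cexpectationZ //; congr (_ * _).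
  rewrite (branching_property hxi n.+1
    (g := fun i => code_value (i \in D) n.+1)); last first.
    by move=> i v; exact: norm_code_value.
  congr (_ * _); rewrite (bigID (mem D)) /=.
  rewrite (eq_bigr (fun=> psi xi N n.+1 s)) => [|i iD]; last by rewrite iD psi_code.
  rewrite [X in _ * X](eq_bigr (fun=> phi xi N n.+1 s)) => [|i /negPf iD]; last first.
    by rewrite iD phi_code.
  rewrite !prodr_const; congr (_ * _ ^+ _).
  by rewrite -[X in (X - _)%N]card_ord -(cardC (mem D)) addKn; apply: eq_card.
rewrite -mulr_sumr; congr (_ * _).
rewrite (sum_sets_card k j
  (fun l => (p k)%:C * (psi xi N n.+1 s ^+ l * phi xi N n.+1 s ^+ (k - l)))) //.
by apply: eq_bigr => l _; ring.
Qed.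

End Generating.
End Offspring.

Theorem theorem2 (R : realType) (d : measure_display)
    (Omega : measurableType d) (P : probability Omega R)
    (p : nat -> R) (xi : seq nat -> {RV P >-> nat}) (N : nat)
    (N_ge1 : (1 <= N)%N)
    (p_ge0 : forall k, 0 <= p k)
    (p_sum1 : series p @ \oo --> (1 : R))
    (p_lt1 : forall k, p k < 1)
    (p_gt0 : exists2 k, (N < k)%N & 0 < p k)
    (hxi : galton_watson p xi) :
  forall (n : nat) (s : R[i]) (j : nat), (1 <= n)%N -> `|s| <= 1 ->
    cexpectation_on P (fun w => s ^+ nu xi n.+1 w)
      [set w | V xi N n.+1 w = j]
    = s * G N (pgf p) (psi xi N n s) (phi xi N n s) j.
Proof.
move=> [//|n] s j _ s_le1; have [k lt_Nk pk_gt0] := p_gt0.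
have phi_lt1 := norm_phi_lt1 N_ge1 p_ge0 hxi s_le1 n (ltnW lt_Nk) pk_gt0.
set x := psi xi N n.+1 s; set y := phi xi N n.+1 s.
(* Convergence of the series of [p] at the point 1 gives convergence at every smaller radius. *)
have p_disc : disc_series p.
  split=> // r /andP[r_ge0 r_lt1]; apply: (@is_cvg_pseries_inside _ _ 1).
    rewrite /pseries; under eq_fun do rewrite expr1n mulr1.
    by apply/cvg_ex; exists 1.
  by rewrite normr1 ger0_norm.
pose Y w := s ^+ nu xi n.+2 w * (V xi N n.+2 w == j)%:R.
have -> : cexpectation_on P (fun w => s ^+ nu xi n.+2 w) [set w | V xi N n.+2 w = j] =
    cexpectation P Y.
  congr cexpectation; apply/funext => w; congr (_ * (nat_of_bool _)%:R).
  by apply/idP/eqP => [/set_mem|/mem_set].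
have Y_unit : unit_rv Y.
  pose g t := s ^+ code_size n.+2 t * (code_subtrees N n.+2 t == j)%:R.
  have -> : Y = fun w => g (tree_rv xi n.+2 [::] w).
    by apply/funext => w; rewrite /Y nu_code V_code.
  apply: unit_rv_comp; first exact: measurable_tree_rv.
  by move=> t; rewrite normrM normrX mulr_ile1 ?exprn_ile1 // norm_bool_le1.
(* The left side is split over the number [k] of children of the ancestor; [rhs] below is the same
   series summed through the derivatives of f, and uniqueness of limits concludes. *)
have lhs := @cexpectation_series _ _ _ P _ _ (measurable_offspring xi [::]) Y_unit.
pose c k l : R[i]^o := real_complex R (p k) * ('C(k, l)%:R * y ^+ (k - l)).
have rhs : (fun m =>
    s * \sum_(j * N <= l < j * N + N) x ^+ l * series (c^~ l) m : R[i]^o)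
    @ \oo --> (s * G N (pgf p) x y j : R[i]^o).
  apply: cvgMr; rewrite /G.
  have -> : \sum_(j * N <= l < j * N + N) x ^+ l / l`!%:R * ((pgf p)^`(l))%classic y =
     \sum_(j * N <= l < j * N + N) x ^+ l * (((pgf p)^`(l))%classic y / l`!%:R).
    by apply: eq_bigr => l _; ring.
  apply: cvg_big; first exact: add_continuous.
  by move=> l _; apply: cvgMr; exact: cvg_derive1n_pgf.
have E : (fun k => cexpectation P (fun w => Y w * (xi [::] w == k)%:R)) =
    (fun k => s * \sum_(j * N <= l < j * N + N) x ^+ l * c k l).
  by apply/funext => k'; exact: cexpectation_generation.
(* The sum over [l] is finite, so it commutes with the partial sums over [k]. *)
have F : (fun m => s * \sum_(j * N <= l < j * N + N) x ^+ l * series (c^~ l) m) =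
    series (fun k => cexpectation P (fun w => Y w * (xi [::] w == k)%:R) : R[i]^o).
  rewrite E; apply/funext => m; rewrite /series /= -mulr_sumr; congr (_ * _).
  by rewrite [RHS]exchange_big /=; apply: eq_bigr => l _; rewrite mulr_sumr.
rewrite F in rhs; exact: (cvg_unique (@norm_hausdorff _ _) lhs rhs).
Qed.
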